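(* Let $k$ be a commutative ring with $1$ and let $(A,C)_\psi$ be the canonical entwining structure associated to a coalgebra-Galois extension $A(B)^C$ over $k$. If there is a normalised integral map in $(A,C)_\psi$, then $B\hookrightarrow A$ is a split extension.
   Context: Algebras are associative unital $k$-algebras, coalgebras coassociative counital $k$-coalgebras, $\otimes=\otimes_k$; $\mu_A$ is the product of $A$, $\Delta_C(c)=c_{(1)}\otimes c_{(2)}$ and $\varepsilon_C$ the coproduct and counit of $C$; the name of a module also denotes its identity map. Coalgebra-Galois extension. Let $C$ be a coalgebra, $A$ an algebra and a right $C$-comodule with coaction $\rho^A:A\to A\otimes C$, and let $B=\{b\in A\mid\rho^A(ba)=b\rho^A(a)\text{ for all }a\in A\}$, a subalgebra of $A$. $B\hookrightarrow A$ is a coalgebra-Galois extension, denoted $A(B)^C$, if the map $\mathrm{can}:A\otimes_BA\to A\otimes C$, $a\otimes a'\mapsto a\rho^A(a')$, is bijective. The associated canonical entwining structure is $(A,C)_\psi$ with $\psi:C\otimes A\to A\otimes C$, $\psi(c\otimes a)=\mathrm{can}(\mathrm{can}^{-1}(1_A\otimes c)a)$. An integral map in $(A,C)_\psi$ is a $k$-linear map $\gamma:C\otimes C\to A$ such that $(\gamma\otimes C)\circ(C\otimes\Delta_C)=\psi\circ(C\otimes\gamma)\circ(\Delta_C\otimes C)$ and $\mu_A\circ(\gamma\otimes A)=\mu_A\circ(A\otimes\gamma)\circ(\psi\otimes C)\circ(C\otimes\psi)$. It is normalised if $\gamma(c_{(1)}\otimes c_{(2)})=\varepsilon_C(c)1_A$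 for all $c\in C$. An extension of algebras $B\hookrightarrow A$ is split if there exists a unital $(B,B)$-bimodule map $E:A\to B$ (unital: $E(1_A)=1_B$). *)

(* Defs.v *)
From HB Require Import structures.
From mathcomp Require Import all_boot all_algebra.
From mathcomp Require Import boolp classical_sets functions.

Set Implicit Arguments.
Unset Strict Implicit.
Unset Printing Implicit Defensive.

Import GRing.Theory.
Local Open Scope ring_scope.
Local Open Scope quotient_scope.

Reserved Notation "M ⊗ N" (at level 40, left associativity).
Reserved Notation "x \ox y" (at level 40, left associativity).

(* Algebras over k in which 1 = 0 is allowed, as it is in k: the library's
   algType excludes the zero algebra.  The module structure is an operation of
   this mixin, because the hierarchy has no join of GRing.PzRing and
   GRing.Lmodule; it is turned into a GRing.Lmodule instance right below. *)
HB.mixin Record isPzAlgebra (k : comPzRingType) A of GRing.PzRing A := {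
  pzscale : k -> A -> A;
  pzscaleA : forall a b x, pzscale a (pzscale b x) = pzscale (a * b) x;
  pzscale1 : left_id 1 pzscale;
  pzscaleDr : right_distributive pzscale +%R;
  pzscaleDl : forall x, {morph pzscale^~ x : a b / a + b};
  pzscale_mull : forall a (x y : A), pzscale a (x * y) = pzscale a x * y;
  pzscale_mulr : forall a (x y : A), pzscale a (x * y) = x * pzscale a y
}.

#[short(type="pzAlgType")]
HB.structure Definition PzAlgebra (k : comPzRingType) :=
  {A of isPzAlgebra k A & GRing.PzRing A}.

#[non_forgetful_inheritance]
HB.instance Definition _ (k : comPzRingType) (A : pzAlgType k) :=
  GRing.Zmodule_isLmodule.Build k (PzAlgebra.sort A)
    (@pzscaleA k A) (@pzscale1 k A) (@pzscaleDr k A) (@pzscaleDl k A).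

Section AlgebraTheory.
Variables (k : comPzRingType) (A : pzAlgType k).
Implicit Types (a : k) (x y : A).

Lemma pzscalerAl a x y : a *: (x * y) = (a *: x) * y.
Proof. exact: pzscale_mull. Qed.
Lemma pzscalerAr a x y : a *: (x * y) = x * (a *: y).
Proof. exact: pzscale_mulr. Qed.

End AlgebraTheory.

Section Multiplications.
Variables (k : comPzRingType) (A : pzAlgType k).

Definition lmul (a x : A) : A := a * x.
Definition rmul (a x : A) : A := x * a.

Fact lmul_is_linear a : linear (lmul a).
Proof. by move=> c x y; rewrite /lmul mulrDr pzscalerAr. Qed.
HB.instance Definition _ a :=
  GRing.isLinear.Build k A A *:%R (lmul a) (lmul_is_linear a).

Fact rmul_is_linear a : linear (rmul a).
Proof. by move=> c x y; rewrite /rmul mulrDl pzscalerAl. Qed.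
HB.instance Definition _ a :=
  GRing.isLinear.Build k A A *:%R (rmul a) (rmul_is_linear a).

End Multiplications.

Section LinearQuotient.
Variables (k : comPzRingType) (V : lmodType k).

Definition submodule (S : set V) : Prop :=
  S 0 /\ forall (a : k) u v, S u -> S v -> S (a *: u + v).

Definition generated (X : set V) : {pred V} := fun v =>
  `[< forall S : set V, submodule S -> (X `<=` S)%classic -> S v >].

Lemma generatedP (X : set V) v :
  reflect (forall S : set V, submodule S -> (X `<=` S)%classic -> S v)
          (v \in generated X).
Proof. exact: asboolP. Qed.

Variable X : set V.

Lemma mem_generated v : X v -> v \in generated X.
Proof. by move=> Xv; apply/generatedP => S _; apply. Qed.

Lemma generatedZD a u v :
  u \in generated X -> v \in generated X -> a *: u + v \in generated X.
Proof.
move=> /generatedP Xu /generatedP Xv; apply/generatedP => S subS XS.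
by apply: subS.2; [apply: Xu | apply: Xv].
Qed.

Fact generated_zmod_closed : zmod_closed (generated X).
Proof.
split=> [|u v Xu Xv]; first by apply/generatedP => S [].
by rewrite addrC -scaleN1r generatedZD.
Qed.
HB.instance Definition _ :=
  GRing.isZmodClosed.Build V (generated X) generated_zmod_closed.

Lemma generatedZ a u : u \in generated X -> a *: u \in generated X.
Proof. by move=> Xu; rewrite -[_ *: _]addr0 generatedZD ?rpred0. Qed.

Definition lquot := Quotient.quot (generated X).
HB.instance Definition _ := GRing.Zmodule.on lquot.

Definition lquot_pi (v : V) : lquot := \pi v.

Lemma lquot_piP u v : (lquot_pi u = lquot_pi v) <-> (u - v \in generated X).
Proof. by rewrite Quotient.idealrBE; split=> [/eqP|/eqP]. Qed.

Lemma lquot_piK (x : lquot) : lquot_pi (repr x) = x.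
Proof. exact: reprK. Qed.

Definition lquot_scale (a : k) (x : lquot) : lquot := lquot_pi (a *: repr x).

Let piD u v : lquot_pi (u + v) = lquot_pi u + lquot_pi v.
Proof. by rewrite /lquot_pi !piE. Qed.

Let piZ a u : lquot_pi (a *: u) = lquot_scale a (lquot_pi u).
Proof.
apply/lquot_piP; rewrite -scalerBr generatedZ //.
by apply/lquot_piP; rewrite lquot_piK.
Qed.

Fact lquot_scalerA a b x :
  lquot_scale a (lquot_scale b x) = lquot_scale (a * b) x.
Proof. by rewrite -[x]lquot_piK -!piZ scalerA. Qed.
Fact lquot_scale1r : left_id 1 lquot_scale.
Proof. by move=> x; rewrite -[x]lquot_piK -!piZ scale1r. Qed.
Fact lquot_scalerDr : right_distributive lquot_scale +%R.
Proof.
by move=> a x y; rewrite -[x]lquot_piK -[y]lquot_piK -piD -!piZ scalerDr piD.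
Qed.
Fact lquot_scalerDl x : {morph lquot_scale^~ x : a b / a + b}.
Proof. by move=> a b; rewrite -[x]lquot_piK -!piZ scalerDl piD. Qed.
HB.instance Definition _ := GRing.Zmodule_isLmodule.Build k lquot
  lquot_scalerA lquot_scale1r lquot_scalerDr lquot_scalerDl.

Fact lquot_pi_is_linear : linear lquot_pi.
Proof. by move=> a u v; rewrite piD piZ. Qed.
HB.instance Definition _ :=
  GRing.isLinear.Build k V lquot *:%R lquot_pi lquot_pi_is_linear.

Variables (W : lmodType k) (f : {linear V -> W}).

Definition lquot_lift of (forall v, X v -> f v = 0) :=
  fun x : lquot => f (repr x).

Hypothesis fX : forall v, X v -> f v = 0.

Lemma lquot_liftE v : lquot_lift fX (lquot_pi v) = f v.
Proof.
apply/eqP; rewrite -subr_eq0 -linearB; apply/eqP.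
have /lquot_piP/generatedP h := lquot_piK (lquot_pi v).
apply: (h (fun u => f u = 0)) => //.
by split=> [|a u w fu fw]; rewrite ?linear0 // linearP fu fw scaler0 addr0.
Qed.

Fact lquot_lift_is_linear : linear (lquot_lift fX).
Proof.
move=> a x y; rewrite -[x]lquot_piK -[y]lquot_piK.
by rewrite -linearP !lquot_liftE linearP.
Qed.

End LinearQuotient.

HB.instance Definition _ (k : comPzRingType) (V : lmodType k) (X : set V)
    (W : lmodType k) (f : {linear V -> W}) (fX : forall v, X v -> f v = 0) :=
  GRing.isLinear.Build k (lquot X) W *:%R (lquot_lift fX)
    (lquot_lift_is_linear fX).

Section FreeModule.
Variables (k : comPzRingType) (T : choiceType).

Definition finsupp_pred : {pred T -> k^o} := fun f =>
  `[< exists s : seq T, forall x, x \notin s -> f x = 0 >].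

Lemma finsuppP (f : T -> k^o) :
  reflect (exists s : seq T, forall x, x \notin s -> f x = 0)
          (f \in finsupp_pred).
Proof. exact: asboolP. Qed.

Fact finsupp_submod_closed : @submod_closed k (T -> k^o) finsupp_pred.
Proof.
split=> [|a f g /finsuppP[s fs] /finsuppP[t gt]]; apply/finsuppP.
  by exists [::].
exists (s ++ t) => x; rewrite mem_cat negb_or => /andP[xs xt].
by rewrite addrfctE scalrfctE /= fs // gt // scaler0 addr0.
Qed.
Record freemod := Freemod { freemod_val : T -> k^o;
                            freemod_subproof : freemod_val \in finsupp_pred }.
HB.instance Definition _ := [isSub for freemod_val].
HB.instance Definition _ := [Choice of freemod by <:].
HB.instance Definition _ :=
  GRing.SubChoice_isSubLmodule.Build k (T -> k^o) finsupp_pred freemod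
    (GRing.submod_closed_semi finsupp_submod_closed).

Fact delta_subproof (x : T) : (fun y => (y == x)%:R : k^o) \in finsupp_pred.
Proof.
by apply/finsuppP; exists [:: x] => y; rewrite inE => /negPf->.
Qed.
Definition delta (x : T) : freemod := Freemod (delta_subproof x).

Definition coef (f : freemod) (x : T) : k := freemod_val f x.

Lemma coef_finite (f : freemod) :
  exists s : seq T, forall x, x \notin s -> coef f x = 0.
Proof. exact/finsuppP/(freemod_subproof f). Qed.

Definition freemod_supp (f : freemod) : seq T :=
  undup (projT1 (cid (coef_finite f))).

Lemma freemod_supp_uniq f : uniq (freemod_supp f).
Proof. exact: undup_uniq. Qed.

Lemma freemod_suppP f x : x \notin freemod_supp f -> coef f x = 0.
Proof.
by rewrite /freemod_supp; case: cid => s fs; rewrite mem_undup; exact: fs.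
Qed.

Variables (W : lmodType k) (g : T -> W).

Definition freemod_lift (f : freemod) : W :=
  \sum_(x <- freemod_supp f) coef f x *: g x.

Lemma freemod_lift_supp (f : freemod) (s : seq T) : uniq s ->
  (forall x, x \notin s -> coef f x = 0) ->
  freemod_lift f = \sum_(x <- s) coef f x *: g x.
Proof.
move=> us fs; rewrite /freemod_lift.
rewrite (bigID (mem s)) [RHS](bigID (mem (freemod_supp f))) /=.
rewrite [X in _ + X]big1 ?addr0; last by move=> x /fs ->; rewrite scale0r.
rewrite [X in _ = _ + X]big1 ?addr0; last first.
  by move=> x /freemod_suppP ->; rewrite scale0r.
rewrite -big_filter -[RHS]big_filter; apply: perm_big; apply: uniq_perm.
- exact: filter_uniq (freemod_supp_uniq f).
- exact: filter_uniq.
- by move=> x; rewrite !mem_filter andbC.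
Qed.

Lemma freemod_liftE x : freemod_lift (delta x) = g x.
Proof.
rewrite (@freemod_lift_supp _ [:: x]) //=; last first.
  by move=> y; rewrite inE => /negPf->.
by rewrite big_seq1 eqxx scale1r.
Qed.

Fact freemod_lift_is_linear : linear freemod_lift.
Proof.
move=> a f h; pose s := undup (freemod_supp f ++ freemod_supp h).
have sf x : x \notin s -> coef f x = 0.
  rewrite mem_undup mem_cat negb_or => /andP[xf _]; exact: freemod_suppP.
have sh x : x \notin s -> coef h x = 0.
  rewrite mem_undup mem_cat negb_or => /andP[_ xh]; exact: freemod_suppP.
have us : uniq s by exact: undup_uniq.
have valE x : coef (a *: f + h) x = a * coef f x + coef h x by [].
rewrite (freemod_lift_supp us sf) (freemod_lift_supp us sh).
rewrite (freemod_lift_supp us); last first.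
  by move=> x xs; rewrite [LHS]valE sf ?sh // mulr0 addr0.
rewrite scaler_sumr -big_split; apply: eq_bigr => x _ /=.
by rewrite scalerA -scalerDl.
Qed.
HB.instance Definition _ :=
  GRing.isLinear.Build k freemod W *:%R freemod_lift freemod_lift_is_linear.

End FreeModule.

Arguments delta {k T} x.

Lemma freemod_ind (k : comPzRingType) (T : choiceType) (S : set (freemod k T)) :
  submodule S -> (forall x, S (delta x)) -> forall f, S f.
Proof.
move=> [S0 SZD] Sd f.
have -> : f = \sum_(x <- freemod_supp f) coef f x *: delta x.
  apply/val_inj/funext => y; transitivity
    (\sum_(x <- freemod_supp f) coef (coef f x *: delta x) y); last first.
    by elim/big_rec2: _ => // x u v _ ->.
  rewrite -[LHS]/(coef f y).
  have [yf|yf] := boolP (y \in freemod_supp f).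
    rewrite (bigD1_seq y) ?freemod_supp_uniq //= big1 => [|x xy].
      by rewrite addr0 -[RHS]/(coef f y * (y == y)%:R) eqxx mulr1.
    by rewrite -[LHS]/(coef f x * (y == x)%:R) eq_sym (negPf xy) mulr0.
  rewrite freemod_suppP // big_seq big1 // => x xf.
  rewrite -[LHS]/(coef f x * (y == x)%:R);
  case: eqP => [yx|_]; last by rewrite mulr0.
  by rewrite yx xf in yf.
by elim: (freemod_supp f) => [|x s IH]; rewrite ?big_nil // big_cons; apply: SZD.
Qed.

Definition bilinear_map (k : comPzRingType) (M N P : lmodType k)
    (f : M -> N -> P) : Prop :=
  (forall n, linear (f^~ n)) /\ (forall m, linear (f m)).

Definition balanced (k : comPzRingType) (M N P : lmodType k)
    (R : M * N -> M * N -> Prop) (f : M -> N -> P) : Prop :=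
  forall p q, R p q -> f p.1 p.2 = f q.1 q.2.

(* The universal k-bilinear map on M x N that identifies the pairs related by R.
   The tensor product over k is the case where R is empty; the tensor product
   over a k-algebra B is the case where R relates (m b, n) to (m, b n). *)
Record tensor_product (k : comPzRingType) (M N : lmodType k)
    (R : M * N -> M * N -> Prop) := TensorProduct {
  tprod :> lmodType k;
  tprod_pure : M -> N -> tprod;
  tprod_bilinear : bilinear_map tprod_pure;
  tprod_balanced : balanced R tprod_pure;
  tprod_lift : forall (P : lmodType k) (f : M -> N -> P),
    bilinear_map f -> balanced R f -> {linear tprod -> P};
  tprod_liftE : forall (P : lmodType k) (f : M -> N -> P)
    (hf : bilinear_map f) (bf : balanced R f) m n,
    tprod_lift hf bf (tprod_pure m n) = f m n;
  tprod_ext : forall (P : lmodType k) (f g : {linear tprod -> P}),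
    (forall m n, f (tprod_pure m n) = g (tprod_pure m n)) -> f =1 g
}.

Section TensorConstruction.
Variables (k : comPzRingType) (M N : lmodType k) (R : M * N -> M * N -> Prop).

Variant tensor_relation : set (freemod k (M * N)%type) :=
  | TensorDl m m' n : tensor_relation
      (delta (m + m', n) - (delta (m, n) + delta (m', n)))
  | TensorDr m n n' : tensor_relation
      (delta (m, n + n') - (delta (m, n) + delta (m, n')))
  | TensorZl (a : k) m n : tensor_relation
      (delta (a *: m, n) - a *: delta (m, n))
  | TensorZr (a : k) m n : tensor_relation
      (delta (m, a *: n) - a *: delta (m, n))
  | TensorBalanced p q of R p q : tensor_relation (delta p - delta q).

Let T : lmodType k := lquot tensor_relation.
Let pure (m : M) (n : N) : T := lquot_pi _ (delta (m, n)).

Let pure_bilinear : bilinear_map pure.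
Proof.
have pureDl m m' n : pure (m + m') n = pure m n + pure m' n.
  by rewrite -linearD; apply/lquot_piP/mem_generated; exact: TensorDl.
have pureDr m n n' : pure m (n + n') = pure m n + pure m n'.
  by rewrite -linearD; apply/lquot_piP/mem_generated; exact: TensorDr.
have pureZl a m n : pure (a *: m) n = a *: pure m n.
  by rewrite -linearZ; apply/lquot_piP/mem_generated; exact: TensorZl.
have pureZr a m n : pure m (a *: n) = a *: pure m n.
  by rewrite -linearZ; apply/lquot_piP/mem_generated; exact: TensorZr.
by split=> [n a m m'|m a n n'];
  [rewrite pureDl pureZl | rewrite pureDr pureZr].
Qed.

Let pure_balanced : balanced R pure.
Proof.
move=> [m n] [m' n'] Rpq; apply/lquot_piP/mem_generated; exact: TensorBalanced.
Qed.

Let lift_subproof (P : lmodType k) (f : M -> N -> P) :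
  bilinear_map f -> balanced R f ->
  forall v, tensor_relation v -> freemod_lift (fun p => f p.1 p.2) v = 0.
Proof.
move=> [fl fr] fR.
have fZl a m n : f (a *: m) n = a *: f m n.
  have f0 : f 0 n = 0.
    by move: (fl n (-1) 0 0); rewrite scaler0 addr0 scaleN1r addNr.
  by have := fl n a m 0; rewrite /= f0 !addr0.
have fZr a m n : f m (a *: n) = a *: f m n.
  have f0 : f m 0 = 0.
    by move: (fr m (-1) 0 0); rewrite scaler0 addr0 scaleN1r addNr.
  by have := fr m a n 0; rewrite f0 !addr0.
move=> _ [m m' n|m n n'|a m n|a m n|p q Rpq];
  apply/eqP; rewrite linearB subr_eq0 /=.
- rewrite linearD /= !freemod_liftE /=.
  by have := fl n 1 m m'; rewrite /= !scale1r => ->.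
- rewrite linearD /= !freemod_liftE /=.
  by have := fr m 1 n n'; rewrite /= !scale1r => ->.
- by rewrite linearZ /= !freemod_liftE /= fZl.
- by rewrite linearZ /= !freemod_liftE /= fZr.
- by rewrite !freemod_liftE (fR _ _ Rpq).
Qed.

Let lift (P : lmodType k) (f : M -> N -> P) (hf : bilinear_map f)
    (bf : balanced R f) : {linear T -> P} := lquot_lift (lift_subproof hf bf).

Let liftE (P : lmodType k) (f : M -> N -> P) (hf : bilinear_map f)
  (bf : balanced R f) m n : lift hf bf (pure m n) = f m n.
Proof. by rewrite [LHS]lquot_liftE [LHS]freemod_liftE. Qed.

Let pure_ext (P : lmodType k) (f g : {linear T -> P}) :
  (forall m n, f (pure m n) = g (pure m n)) -> f =1 g.
Proof.
move=> fg x; rewrite -[x]lquot_piK.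
apply: (@freemod_ind _ _
  (fun v => f (lquot_pi _ v) = g (lquot_pi _ v))) => [|[m n]]; last exact: fg.
split=> [|a u v fu fv]; first by rewrite !linear0.
by rewrite linearP (linearP f) (linearP g) fu fv.
Qed.

(* Opaque: only the universal property matters. *)
Lemma tensor_over : tensor_product R.
Proof.
exact: (@TensorProduct k M N R T pure pure_bilinear pure_balanced
          (@lift) (@liftE) (@pure_ext)).
Qed.

End TensorConstruction.

Section TensorTheory.
Variables (k : comPzRingType) (M N : lmodType k).
Variables (R : M * N -> M * N -> Prop) (T : tensor_product R).
Local Notation pure := (tprod_pure T).

Lemma tprodDl m m' n : pure (m + m') n = pure m n + pure m' n.
Proof. by have := (tprod_bilinear T).1 n 1 m m'; rewrite !scale1r. Qed.
Lemma tprodDr m n n' : pure m (n + n') = pure m n + pure m n'.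
Proof. by have := (tprod_bilinear T).2 m 1 n n'; rewrite !scale1r. Qed.
Lemma tprod0l n : pure 0 n = 0.
Proof. by apply: (addrI (pure 0 n)); rewrite -tprodDl !addr0. Qed.
Lemma tprod0r m : pure m 0 = 0.
Proof. by apply: (addrI (pure m 0)); rewrite -tprodDr !addr0. Qed.
Lemma tprodZl a m n : pure (a *: m) n = a *: pure m n.
Proof.
by have := (tprod_bilinear T).1 n a m 0; rewrite /= tprod0l !addr0.
Qed.
Lemma tprodZr a m n : pure m (a *: n) = a *: pure m n.
Proof. by have := (tprod_bilinear T).2 m a n 0; rewrite tprod0r !addr0. Qed.

Lemma tprod_ext_lin (P : lmodType k) a (f g h : {linear T -> P}) :
  (forall m n, f (pure m n) = a *: g (pure m n) + h (pure m n)) ->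
  forall x, f x = a *: g x + h x.
Proof. by move=> fgh; apply: (@tprod_ext _ _ _ _ T _ f (a \*: g \+ h)). Qed.

End TensorTheory.

Section Tensor.
Variables (k : comPzRingType) (M N : lmodType k).

Definition tensor : lmodType k :=
  tensor_over (fun _ _ : M * N => False).
Definition tpure : M -> N -> tensor := tprod_pure _.

Definition tlift (P : lmodType k) (f : M -> N -> P) (hf : bilinear_map f) :
  {linear tensor -> P} := tprod_lift _ hf (fun _ _ => False_ind _).

End Tensor.

Notation "M ⊗ N" := (tensor M N) : type_scope.
Notation "x \ox y" := (tpure x y) : ring_scope.

Section TensorTheory.
Variables (k : comPzRingType) (M N : lmodType k).
Implicit Types (a : k) (m : M) (n : N).

Lemma tpureDl m m' n : (m + m') \ox n = m \ox n + m' \ox n.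
Proof. exact: tprodDl. Qed.
Lemma tpureDr m n n' : m \ox (n + n') = m \ox n + m \ox n'.
Proof. exact: tprodDr. Qed.
Lemma tpureZl a m n : (a *: m) \ox n = a *: (m \ox n).
Proof. exact: tprodZl. Qed.
Lemma tpureZr a m n : m \ox (a *: n) = a *: (m \ox n).
Proof. exact: tprodZr. Qed.

Lemma tliftE (P : lmodType k) (f : M -> N -> P) (hf : bilinear_map f) m n :
  tlift hf (m \ox n) = f m n.
Proof. exact: tprod_liftE. Qed.

Lemma tensor_ext (P : lmodType k) (f g : {linear M ⊗ N -> P}) :
  (forall m n, f (m \ox n) = g (m \ox n)) -> f =1 g.
Proof. exact: tprod_ext. Qed.

Lemma tensor_ext_lin (P : lmodType k) a (f g h : {linear M ⊗ N -> P}) :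
  (forall m n, f (m \ox n) = a *: g (m \ox n) + h (m \ox n)) ->
  forall x, f x = a *: g x + h x.
Proof. exact: tprod_ext_lin. Qed.

End TensorTheory.

#[global] Opaque tensor tpure tlift.

Section TensorMaps.
Variable k : comPzRingType.
Implicit Types M N P : lmodType k.

Fact tmap_subproof M M' N N' (f : {linear M -> M'}) (g : {linear N -> N'}) :
  bilinear_map (fun m n => f m \ox g n).
Proof.
by split=> [n a m m'|m a n n'] /=;
  rewrite linearP (tpureDl, tpureDr) (tpureZl, tpureZr).
Qed.
Definition tmap M M' N N' (f : {linear M -> M'}) (g : {linear N -> N'}) :
  {linear M ⊗ N -> M' ⊗ N'} := tlift (tmap_subproof f g).

Lemma tmapE M M' N N' (f : {linear M -> M'}) (g : {linear N -> N'}) m n :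
  tmap f g (m \ox n) = f m \ox g n.
Proof. exact: tliftE. Qed.
#[global] Opaque tmap.

Fact tassoc_subproof1 M N P (p : P) :
  bilinear_map (fun (m : M) (n : N) => m \ox (n \ox p)).
Proof.
by split=> [n a m m'|m a n n'];
  rewrite ?tpureDl ?tpureZl ?tpureDr ?tpureZr.
Qed.
Fact tassoc_subproof2 M N P :
  bilinear_map (fun (x : M ⊗ N) (p : P) => tlift (tassoc_subproof1 M N p) x).
Proof.
split=> [p a x y|x a p q]; first exact: linearP.
move: x; apply: tensor_ext_lin => m n.
by rewrite !tliftE !tpureDr !tpureZr.
Qed.
Definition tassoc M N P : {linear (M ⊗ N) ⊗ P -> M ⊗ (N ⊗ P)} :=
  tlift (tassoc_subproof2 M N P).

Lemma tassocE M N P (m : M) (n : N) (p : P) :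
  tassoc M N P ((m \ox n) \ox p) = m \ox (n \ox p).
Proof. by rewrite !tliftE. Qed.

Fact tassocV_subproof1 M N P (m : M) :
  bilinear_map (fun (n : N) (p : P) => (m \ox n) \ox p).
Proof.
by split=> [p a n n'|n a p p'];
  rewrite ?tpureDr ?tpureZr ?tpureDl ?tpureZl.
Qed.
Fact tassocV_subproof2 M N P :
  bilinear_map (fun (m : M) (x : N ⊗ P) => tlift (tassocV_subproof1 N P m) x).
Proof.
split=> [x a m m'|m a x y]; last exact: linearP.
move: x; apply: tensor_ext_lin => n p.
by rewrite !tliftE !tpureDl !tpureZl.
Qed.
Definition tassocV M N P : {linear M ⊗ (N ⊗ P) -> (M ⊗ N) ⊗ P} :=
  tlift (tassocV_subproof2 M N P).

Lemma tassocVE M N P (m : M) (n : N) (p : P) :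
  tassocV M N P (m \ox (n \ox p)) = (m \ox n) \ox p.
Proof. by rewrite !tliftE. Qed.

Fact tunitl_subproof M : bilinear_map (fun (a : k^o) (m : M) => a *: m).
Proof.
split=> [m a b c|b a m m']; first by rewrite scalerDl scalerA.
by rewrite scalerDr !scalerA mulrC.
Qed.
Definition tunitl M : {linear k^o ⊗ M -> M} := tlift (tunitl_subproof M).

Fact tunitr_subproof M : bilinear_map (fun (m : M) (a : k^o) => a *: m).
Proof. by case: (tunitl_subproof M). Qed.
Definition tunitr M : {linear M ⊗ k^o -> M} := tlift (tunitr_subproof M).

End TensorMaps.

Section Product.
Variables (k : comPzRingType) (A : pzAlgType k).

Fact mult_subproof : bilinear_map (fun x y : A => x * y).
Proof.
split=> [y a x x'|x a y y'].
  by rewrite mulrDl pzscalerAl.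
by rewrite mulrDr pzscalerAr.
Qed.
Definition mult : {linear A ⊗ A -> A} := tlift mult_subproof.

End Product.

HB.mixin Record isCoalgebra (k : comPzRingType) C of GRing.Lmodule k C := {
  comul : {linear C -> C ⊗ C};
  counit : {linear C -> k^o};
  comulA : forall c, tassoc C C C (tmap comul idfun (comul c)) =
                     tmap idfun comul (comul c);
  comul_counitl : forall c, tunitl C (tmap counit idfun (comul c)) = c;
  comul_counitr : forall c, tunitr C (tmap idfun counit (comul c)) = c
}.

#[short(type="coalgType")]
HB.structure Definition Coalgebra (k : comPzRingType) :=
  {C of isCoalgebra k C & GRing.Lmodule k C}.

Record right_coaction (k : comPzRingType) (C : coalgType k) (M : lmodType k) :=
  RightCoaction {
    coact :> {linear M -> M ⊗ C};
    coactA : forall m, tassoc M C C (tmap coact idfun (coact m)) =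
                       tmap idfun comul (coact m);
    coact_counit : forall m, tunitr M (tmap idfun counit (coact m)) = m
  }.

Section Coinvariants.
Variables (k : comPzRingType) (C : coalgType k) (A : pzAlgType k).

Definition lact (a : A) : {linear A ⊗ C -> A ⊗ C} := tmap (lmul a) idfun.

Lemma lactE a a' c : lact a (a' \ox c) = (a * a') \ox c.
Proof. exact: tmapE. Qed.

Lemma lactM a b x : lact (a * b) x = lact a (lact b x).
Proof.
move: x; apply: (@tensor_ext _ _ _ _ (lact (a * b)) (lact a \o lact b)).
by move=> a' c; rewrite /= !lactE mulrA.
Qed.
Lemma lact1 x : lact 1 x = x.
Proof.
move: x; apply: (@tensor_ext _ _ _ _ (lact 1) idfun).
by move=> a' c; rewrite lactE mul1r.
Qed.
Lemma lact_linearl x : linear (lact^~ x).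
Proof.
move=> z a b; move: x; apply: tensor_ext_lin => a' c.
by rewrite !lactE mulrDl -pzscalerAl tpureDl tpureZl.
Qed.

Variable rho : right_coaction C A.

Definition coinv_pred : {pred A} := fun b =>
  `[< forall a : A, rho (b * a) = lact b (rho a) >].

Lemma coinvP b :
  reflect (forall a : A, rho (b * a) = lact b (rho a)) (b \in coinv_pred).
Proof. exact: asboolP. Qed.

Fact coinv_subring_closed : subring_closed coinv_pred.
Proof.
split=> [|b b' /coinvP Bb /coinvP Bb'|b b' /coinvP Bb /coinvP Bb'];
  apply/coinvP => a.
- by rewrite mul1r lact1.
- rewrite mulrBl linearB /= Bb Bb' addrC -scaleN1r.
  by rewrite -(lact_linearl (rho a) (-1) b' b) scaleN1r addrC.
- by rewrite -mulrA Bb Bb' lactM.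
Qed.
Fact coinv_submod_closed : @submod_closed k A coinv_pred.
Proof.
split=> [|z b b' /coinvP Bb /coinvP Bb']; apply/coinvP => a.
  rewrite mul0r linear0; have := lact_linearl (rho a) (-1) 0 0.
  by rewrite /= scaler0 addr0 scaleN1r addNr.
by rewrite mulrDl -pzscalerAl linearP /= Bb Bb' -lact_linearl.
Qed.

(* The subalgebra B, included in A by coinv_val. *)
Record coinv := Coinv { coinv_val : A;
                        coinv_subproof : coinv_val \in coinv_pred }.
HB.instance Definition _ := [isSub for coinv_val].
HB.instance Definition _ := [Choice of coinv by <:].
HB.instance Definition _ := GRing.SubChoice_isSubPzRing.Build
  A coinv_pred coinv coinv_subring_closed.
HB.instance Definition _ := GRing.SubZmodule_isSubLmodule.Build
  k A coinv_pred coinv (GRing.submod_closed_semi coinv_submod_closed).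

Fact coinv_scalerAl (a : k) (x y : coinv) : a *: (x * y) = (a *: x) * y.
Proof. by apply/val_inj; rewrite /= pzscalerAl. Qed.
Fact coinv_scalerAr (a : k) (x y : coinv) : a *: (x * y) = x * (a *: y).
Proof. by apply/val_inj; rewrite /= pzscalerAr. Qed.
HB.instance Definition _ := isPzAlgebra.Build k coinv
  (@scalerA k coinv) (@scale1r k coinv) (@scalerDr k coinv) (@scalerDl k coinv)
  coinv_scalerAl coinv_scalerAr.

End Coinvariants.

Section RelativeTensor.
Variables (k : comPzRingType) (B A : pzAlgType k) (iota : B -> A).

(* A ⊗_B A, where B acts on A through iota. *)
Variant over_relation : A * A -> A * A -> Prop :=
  OverRelation x b y : over_relation (x * iota b, y) (x, iota b * y).
Definition rtensor : lmodType k := tensor_over over_relation.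
Definition rpure : A -> A -> rtensor := tprod_pure _.

Lemma rpure_balanced x b y : rpure (x * iota b) y = rpure x (iota b * y).
Proof.
exact: (@tprod_balanced _ _ _ _ (tensor_over _) _ _ (OverRelation x b y)).
Qed.

Fact ract_bilinear (a : A) : bilinear_map (fun x y : A => rpure x (y * a)).
Proof.
split=> [y z x x'|x z y y'] /=; first by rewrite /rpure tprodDl tprodZl.
by rewrite /rpure mulrDl -pzscalerAl tprodDr tprodZr.
Qed.
Fact ract_balanced (a : A) :
  balanced over_relation (fun x y : A => rpure x (y * a)).
Proof.
by move=> _ _ [x b y] /=; rewrite -mulrA rpure_balanced.
Qed.
Definition ract (a : A) : {linear rtensor -> rtensor} :=
  tprod_lift _ (ract_bilinear a) (ract_balanced a).

Lemma ractE a x y : ract a (rpure x y) = rpure x (y * a).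
Proof. exact: tprod_liftE. Qed.

Lemma ract_linearl t : linear (ract^~ t).
Proof.
move=> z a b; move: t; apply: tprod_ext_lin => x y.
by rewrite !ractE mulrDr -pzscalerAr /rpure tprodDr tprodZr.
Qed.

End RelativeTensor.

Section CoalgebraGalois.
Variables (k : comPzRingType) (C : coalgType k) (A : pzAlgType k).
Variable rho : right_coaction C A.

Local Notation iota := (@coinv_val k C A rho).

Fact can_bilinear : bilinear_map (fun a a' : A => lact C a (rho a')).
Proof.
split=> [a' z x y|a z x y]; first exact: lact_linearl.
by rewrite (linearP rho) linearP.
Qed.
Fact can_balanced : balanced (over_relation iota)
  (fun a a' : A => lact C a (rho a')).
Proof.
move=> _ _ [x b y] /=; rewrite lactM.
by have /coinvP -> := coinv_subproof b.
Qed.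

Definition can : {linear rtensor iota -> A ⊗ C} :=
  tprod_lift _ can_bilinear can_balanced.

Lemma canE a a' : can (rpure _ a a') = lact C a (rho a').
Proof. exact: tprod_liftE. Qed.

Definition coalgebra_galois : Prop := bijective can.

Hypothesis galois : coalgebra_galois.

Lemma can_inv_subproof :
  exists g : A ⊗ C -> rtensor iota,
    cancel can g /\ cancel g can.
Proof. by case: galois => g canK gK; exists g. Qed.
Definition can_inv : A ⊗ C -> rtensor iota :=
  projT1 (cid can_inv_subproof).
Lemma canK : cancel can can_inv.
Proof. exact: (projT2 (cid can_inv_subproof)).1. Qed.
Lemma can_invK : cancel can_inv can.
Proof. exact: (projT2 (cid can_inv_subproof)).2. Qed.

Lemma can_inv_linear : linear can_inv.
Proof.
by move=> a x y; apply: (can_inj canK); rewrite linearP !can_invK.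
Qed.

Fact entwining_bilinear :
  bilinear_map (fun (c : C) (a : A) => can (ract _ a (can_inv ((1 : A) \ox c)))).
Proof.
split=> [a z c c'|c z a a'] /=.
  by rewrite tpureDr tpureZr can_inv_linear !linearP.
by rewrite ract_linearl linearP.
Qed.

Definition canonical_entwining : {linear C ⊗ A -> A ⊗ C} :=
  tlift entwining_bilinear.

Lemma canonical_entwiningE c a :
  canonical_entwining (c \ox a) = can (ract _ a (can_inv ((1 : A) \ox c))).
Proof. exact: tliftE. Qed.

End CoalgebraGalois.

Section IntegralMaps.
Variables (k : comPzRingType) (C : coalgType k) (A : pzAlgType k).
Variables (psi : {linear C ⊗ A -> A ⊗ C}) (gamma : {linear C ⊗ C -> A}).

Definition integral_map : Prop :=
  (forall x : C ⊗ C,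
     tmap gamma idfun (tassocV C C C (tmap idfun comul x)) =
     psi (tmap idfun gamma (tassoc C C C (tmap comul idfun x)))) /\
  (forall x : (C ⊗ C) ⊗ A,
     mult A (tmap gamma idfun x) =
     mult A (tmap idfun gamma (tassoc A C C (tmap psi idfun
       (tassocV C A C (tmap idfun psi (tassoc C C A x))))))).

Definition normalised : Prop :=
  forall c : C, gamma (comul c) = (counit c : k) *: (1 : A).

End IntegralMaps.

Definition split_extension (k : comPzRingType) (B A : pzAlgType k)
    (iota : B -> A) : Prop :=
  exists E : {linear A -> B},
    [/\ E (1 : A) = (1 : B),
        forall (b : B) (a : A), E (iota b * a) = b * E a &
        forall (a : A) (b : B), E (a * iota b) = E a * b].

(* Main.v *)
Require Import Defs.
From mathcomp Require Import all_boot all_algebra.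
From HB Require Import structures.

Set Implicit Arguments.
Unset Strict Implicit.
Unset Printing Implicit Defensive.

Import GRing.Theory.
Local Open Scope ring_scope.

(** In Sweedler notation write rho(a) = a0 ⊗ a1 and let A act on A ⊗ C from the
    right by (a ⊗ c).b = a psi(c ⊗ b).  The definition of psi says exactly that
    this action is the transport along can of right multiplication on A ⊗_B A;
    since rho(a) = can(1 ⊗_B a), it follows that rho(a b) = rho(a).b, so A is an
    entwined module ([coactM]).

    An integral map gamma yields the map Phi : A ⊗ C -> A,
    Phi(a ⊗ c) = a0 gamma(a1 ⊗ c) ([retraction]).  Normalisation of gamma gives
    Phi(rho(a)) = a ([retractionK]); the second integral identity makes Phi right
    A-linear ([retraction_entw_act]) and the first makes it right C-colinear
    ([retraction_colinear]).  It is left B-linear because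
    rho(b a) = b rho(a) for b in B ([retraction_coinv]).

    The splitting is E(a) = Phi(a rho(1)).  From (a rho(1)).b = a rho(b) and right
    linearity, Phi(a rho(b)) = E(a) b ([retraction_lact_coact]).  Applying rho to
    this identity and using colinearity gives rho(E(a) b) = E(a) rho(b), so E takes
    values in B.  Finally E(1) = Phi(rho(1)) = 1, left B-linearity of E is that of
    Phi, and E(a b) = Phi(a b rho(1)) = Phi(a rho(b)) = E(a) b for b in B. *)

(** * Induction on tensors *)

(** Pure tensors absorb scalars, so additive closure is all that has to be checked.
    The universal property alone suffices: the quotient map by the submodule of
    all y whose multiples satisfy S vanishes on pure tensors, hence everywhere. *)
Lemma tprod_ind (k : comPzRingType) (M N : lmodType k)
    (R : M * N -> M * N -> Prop) (T : tensor_product R) (S : T -> Prop) :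
  (forall m n, S (tprod_pure T m n)) ->
  (forall x y, S x -> S y -> S (x + y)) -> forall x, S x.
Proof.
move=> Sp SD x; pose S' := fun y : T => forall a : k, S (a *: y).
have subS' : submodule S'.
  split=> [a|a u v Su Sv b].
    by rewrite scaler0 -(tprod0l T 0); apply: Sp.
  by rewrite scalerDr scalerA; apply: SD.
suff /generatedP/(_ S' subS')/(_ (fun _ => id)) : x \in generated S'.
  by move/(_ 1); rewrite scale1r.
rewrite -[x]subr0; apply/lquot_piP; rewrite linear0.
apply: (@tprod_ext _ _ _ _ T _ (lquot_pi S') \0) => m n.
rewrite -[RHS](linear0 (lquot_pi S')); apply/lquot_piP; rewrite subr0.
by apply: mem_generated => a; rewrite -tprodZl; apply: Sp.
Qed.

Lemma tensor_ind (k : comPzRingType) (M N : lmodType k) (S : M ⊗ N -> Prop) :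
  (forall m n, S (m \ox n)) ->
  (forall x y, S x -> S y -> S (x + y)) -> forall x, S x.
Proof. exact: tprod_ind. Qed.

Lemma tassocK (k : comPzRingType) (M N P : lmodType k) :
  cancel (tassoc M N P) (tassocV M N P).
Proof.
elim/tensor_ind => [x p|x y IHx IHy]; last by rewrite !linearD /= IHx IHy.
elim/tensor_ind: x => [m n|x y IHx IHy]; first by rewrite tassocE tassocVE.
by rewrite tpureDl !linearD /= IHx IHy.
Qed.

(** * The right action of the algebra on A ⊗ C *)

Section CanonicalEntwining.
Variables (k : comPzRingType) (C : coalgType k) (A : pzAlgType k).

Lemma multE (x y : A) : mult A (x \ox y) = x * y.
Proof. exact: tliftE. Qed.

(** [lact] as a map out of a tensor product, so that it can be composed with maps
    applied to an undetermined tensor. *)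
Definition lactT : {linear A ⊗ (A ⊗ C) -> A ⊗ C} :=
  tmap (mult A) idfun \o tassocV A A C.

Lemma lactTE a x : lactT (a \ox x) = lact C a x.
Proof.
elim/tensor_ind: x => [b c|x y IHx IHy].
  by rewrite /= tassocVE tmapE lactE multE.
by rewrite tpureDr !linearD IHx IHy.
Qed.

(** The right action (a ⊗ c) ⊗ b |-> a psi(c ⊗ b) of the entwined module A ⊗ C. *)
Definition entw_act (psi : {linear C ⊗ A -> A ⊗ C}) :
    {linear (A ⊗ C) ⊗ A -> A ⊗ C} :=
  lactT \o (tmap idfun psi \o tassoc A C A).

Lemma entw_actE psi a c b :
  entw_act psi ((a \ox c) \ox b) = lact C a (psi (c \ox b)).
Proof. by rewrite -lactTE /= tassocE tmapE. Qed.

Lemma entw_act_lact psi a x b :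
  entw_act psi (lact C a x \ox b) = lact C a (entw_act psi (x \ox b)).
Proof.
elim/tensor_ind: x => [a' c|x y IHx IHy].
  by rewrite lactE !entw_actE lactM.
by rewrite linearD !tpureDl !linearD IHx IHy.
Qed.

Variables (rho : right_coaction C A) (galois : coalgebra_galois rho).
Local Notation psi := (canonical_entwining galois).
Local Notation iota := (@coinv_val k C A rho).

(** Left A-linearity of can, compatibly with right multiplication by b: the
    witness t' is the left multiple a t in A ⊗_B A. *)
Lemma can_left_translate (a b : A) (t : rtensor iota) :
  exists2 t', can rho t' = lact C a (can rho t) &
    can rho (ract _ b t') = lact C a (can rho (ract _ b t)).
Proof.
elim/tprod_ind: t => [x y|t u [t' Et Etb] [u' Eu Eub]].
  exists (rpure _ (a * x) y); rewrite -/(rpure _ x y) ?ractE !canE ?lactM //.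
by exists (t' + u'); rewrite !linearD /= ?Et ?Eu ?Etb ?Eub.
Qed.

(** For x = 1 ⊗ c this is the definition of psi; left A-linearity of can carries it
    to a ⊗ c. *)
Lemma entw_act_can (x : A ⊗ C) (b : A) :
  entw_act psi (x \ox b) = can rho (ract _ b (can_inv galois x)).
Proof.
elim/tensor_ind: x => [a c|x y IHx IHy].
  rewrite entw_actE canonical_entwiningE.
  have [t Et <-] := can_left_translate a b (can_inv galois ((1 : A) \ox c)).
  congr (can rho (ract _ b _)).
  by apply: (can_inj (canK galois)); rewrite Et !can_invK lactE mulr1.
rewrite tpureDl linearD IHx IHy -[x]scale1r (can_inv_linear galois).
by rewrite !scale1r !linearD.
Qed.

(** A is an entwined module, because rho(a) = can(1 ⊗_B a) and right
    multiplication by b turns 1 ⊗_B a into 1 ⊗_B a b. *)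
Lemma coactM a b : rho (a * b) = entw_act psi (rho a \ox b).
Proof.
rewrite entw_act_can -[rho a]lact1 -canE canK ractE canE.
by rewrite lact1.
Qed.

(** * The retraction of the coaction given by an integral map *)

Section Retraction.
Variable gamma : {linear C ⊗ C -> A}.

Definition gamma_mul : {linear (A ⊗ C) ⊗ C -> A} :=
  mult A \o (tmap idfun gamma \o tassoc A C C).

Lemma gamma_mulE a c d : gamma_mul ((a \ox c) \ox d) = a * gamma (c \ox d).
Proof. by rewrite /= tassocE tmapE multE. Qed.

Definition retraction : {linear A ⊗ C -> A} :=
  gamma_mul \o tmap rho idfun.

Lemma retractionE a c : retraction (a \ox c) = gamma_mul (rho a \ox c).
Proof. by rewrite /= tmapE. Qed.

Lemma gamma_mul_lact a x d :
  gamma_mul (lact C a x \ox d) = a * gamma_mul (x \ox d).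
Proof.
elim/tensor_ind: x => [b c|x y IHx IHy]; first by rewrite lactE !gamma_mulE mulrA.
by rewrite linearD !tpureDl !linearD IHx IHy mulrDr.
Qed.

Lemma retraction_coinv b x : b \in coinv_pred rho ->
  retraction (lact C b x) = b * retraction x.
Proof.
move=> /coinvP Bb; elim/tensor_ind: x => [a c|x y IHx IHy].
  by rewrite lactE !retractionE Bb gamma_mul_lact.
by rewrite !linearD IHx IHy mulrDr.
Qed.

(** By coassociativity a0 gamma(a1 ⊗ a2) = a0 epsilon(a1) = a. *)
Lemma retractionK : normalised gamma -> cancel rho retraction.
Proof.
move=> gamma1 a; rewrite /= coactA -[RHS](coact_counit rho).
elim/tensor_ind: (rho a) => [b c|x y IHx IHy]; last by rewrite !linearD IHx IHy.
by rewrite !tmapE multE gamma1 -pzscalerAr mulr1 [RHS]tliftE.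
Qed.

Hypothesis gammaP : integral_map psi gamma.

(** The coaction turns Phi(a psi(c ⊗ b)) into a0 times the right-hand side of the
    second integral identity at a1 ⊗ c ⊗ b, that is a0 gamma(a1 ⊗ c) b. *)
Lemma retraction_entw_act x b :
  retraction (entw_act psi (x \ox b)) = retraction x * b.
Proof.
elim/tensor_ind: x => [a c|x y IHx IHy]; last first.
  by rewrite tpureDl !linearD IHx IHy mulrDl.
rewrite entw_actE retractionE.
pose G : {linear C ⊗ (A ⊗ C) -> A} :=
  gamma_mul \o (tmap psi idfun \o tassocV C A C).
have -> z : retraction (lact C a z) =
    mult A (tmap idfun G (tassoc A C _ (rho a \ox z))).
  (* Used at z = psi(c ⊗ b), which need not be a pure tensor. *)
  elim/tensor_ind: z => [a' d|z w IHz IHw]; last first.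
    by rewrite tpureDr !linearD IHz IHw.
  rewrite lactE retractionE coactM.
  elim/tensor_ind: (rho a) => [a0 c0|y w IHy IHw]; last first.
    by rewrite !tpureDl !linearD tpureDl !linearD IHy IHw.
  rewrite entw_actE gamma_mul_lact tassocE tmapE multE.
  by rewrite /G [in RHS]/= tassocVE tmapE.
elim/tensor_ind: (rho a) => [a0 c0|y w IHy IHw]; last first.
  by rewrite !tpureDl !linearD IHy IHw mulrDl.
rewrite tassocE tmapE multE gamma_mulE -mulrA; congr (_ * _).
have := gammaP.2 ((c0 \ox c) \ox b).
by rewrite tassocE !tmapE multE => ->.
Qed.

(** The entwined module law gives rho(a0 gamma(a1 ⊗ c)) = a0 psi(a1 ⊗ gamma(a2 ⊗ c)),
    and the first integral identity turns this into a0 gamma(a1 ⊗ c1) ⊗ c2. *)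
Lemma retraction_colinear x :
  rho (retraction x) =
  tmap retraction idfun (tassocV A C C (tmap idfun comul x)).
Proof.
elim/tensor_ind: x => [a c|x y IHx IHy]; last by rewrite !linearD IHx IHy.
rewrite retractionE tmapE.
pose G : {linear C ⊗ (C ⊗ C) -> A ⊗ C} := tmap gamma idfun \o tassocV C C C.
(* Here d replaces the coproduct of c, so that both sides can be computed on
   pure tensors; G is then ready for the first integral identity. *)
have -> d : tmap retraction idfun (tassocV A C C (a \ox d)) =
    lactT (tmap idfun G (tassoc A C _ (rho a \ox d))).
  elim/tensor_ind: d => [c1 c2|d e IHd IHe]; last first.
    by rewrite !tpureDr !linearD IHd IHe.
  rewrite tassocVE tmapE retractionE.
  elim/tensor_ind: (rho a) => [a0 c0|y w IHy IHw]; last first.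
    by rewrite !tpureDl !linearD tpureDl IHy IHw.
  rewrite gamma_mulE tassocE tmapE lactTE /G [in RHS]/= tassocVE tmapE lactE.
  by [].
pose L : {linear ((A ⊗ C) ⊗ C) ⊗ C -> A ⊗ C} :=
  entw_act psi \o (tmap idfun gamma \o tassoc (A ⊗ C) C C).
have -> y : rho (gamma_mul (y \ox c)) = L (tmap rho idfun y \ox c).
  elim/tensor_ind: y => [a0 c0|y w IHy IHw]; last first.
    by rewrite linearD !tpureDl !linearD IHy IHw.
  by rewrite gamma_mulE coactM tmapE /L [in RHS]/= tassocE tmapE.
(* The argument of L is now (a0 ⊗ a1 ⊗ a2) ⊗ c, an iterated coaction; coassociativity
   exposes the coproduct of a1 that the first integral identity needs. *)
rewrite -[tmap rho _ _]tassocK coactA.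
elim/tensor_ind: (rho a) => [a0 c0|y w IHy IHw]; last first.
  by rewrite !linearD !tpureDl !linearD IHy IHw.
rewrite tmapE tassocE tmapE lactTE.
have -> d : L (tassocV A C C (a0 \ox d) \ox c) =
    lact C a0 (psi (tmap idfun gamma (tassoc C C C (d \ox c)))).
  elim/tensor_ind: d => [c1 c2|d e IHd IHe]; last first.
    by rewrite tpureDr linearD !tpureDl !linearD IHd IHe.
  by rewrite tassocVE [LHS]/= !tassocE !tmapE -lactTE /= tassocE tmapE.
congr (lact C a0 _).
by have := gammaP.1 (c0 \ox c); rewrite !tmapE => <-.
Qed.

(** * The splitting *)

(** Right linearity of the retraction, applied to a rho(b) = (a rho(1)).b. *)
Lemma retraction_lact_coact a b :
  retraction (lact C a (rho b)) = retraction (lact C a (rho 1)) * b.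
Proof.
by rewrite -retraction_entw_act entw_act_lact -coactM mul1r.
Qed.

(** Since E(a) b = Phi(a rho(b)), colinearity and coassociativity give
    rho(E(a) b) = Phi(a b0 ⊗ b1) ⊗ b2 = Phi(a rho(b0)) ⊗ b1 = E(a) b0 ⊗ b1. *)
Lemma retraction_lact_coact1 a :
  retraction (lact C a (rho 1)) \in coinv_pred rho.
Proof.
apply/coinvP => b; rewrite -retraction_lact_coact retraction_colinear.
have -> x : tmap idfun comul (lact C a x) =
            tmap (lmul a) idfun (tmap idfun comul x).
  elim/tensor_ind: x => [a0 c|x y IHx IHy]; last by rewrite !linearD IHx IHy.
  by rewrite lactE !tmapE.
rewrite -coactA.
elim/tensor_ind: (rho b) => [a0 c|x y IHx IHy]; last by rewrite !linearD IHx IHy.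
rewrite lactE tmapE -retraction_lact_coact.
elim/tensor_ind: (rho a0) => [a1 c1|x y IHx IHy]; last first.
  by rewrite !tpureDl !linearD tpureDl IHx IHy.
by rewrite tassocE tmapE tassocVE tmapE lactE.
Qed.

Definition coinv_split (a : A) : coinv rho :=
  Coinv (retraction_lact_coact1 a).

Fact coinv_split_is_linear : linear coinv_split.
Proof.
move=> z a b; apply/val_inj.
have lactP : lact C (z *: a + b) (rho 1) =
    z *: lact C a (rho 1) + lact C b (rho 1) by exact: lact_linearl.
by rewrite -[LHS]/(retraction (lact C (z *: a + b) (rho 1))) lactP linearP.
Qed.
HB.instance Definition _ :=
  GRing.isLinear.Build k A (coinv rho) *:%R coinv_split coinv_split_is_linear.

End Retraction.
End CanonicalEntwining.

Theorem proposition5p8 (k : comPzRingType) (C : coalgType k) (A : pzAlgType k)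
    (rho : right_coaction C A) (galois : coalgebra_galois rho) :
  (exists gamma : {linear C ⊗ C -> A},
     integral_map (canonical_entwining galois) gamma /\ normalised gamma) ->
  split_extension (@coinv_val k C A rho).
Proof.
move=> [gamma [gammaP gamma1]]; exists (coinv_split gammaP).
split=> [|b a|a b]; apply/val_inj.
- by rewrite -[LHS]/(retraction rho gamma (lact C 1 (rho 1))) lact1 retractionK.
- rewrite -[LHS]/(retraction rho gamma (lact C (coinv_val b * a) (rho 1))).
  by rewrite lactM retraction_coinv ?coinv_subproof.
- rewrite -[LHS]/(retraction rho gamma (lact C (a * coinv_val b) (rho 1))).
  rewrite lactM.
  have /coinvP/(_ 1) <- := coinv_subproof b; rewrite mulr1.
  exact: retraction_lact_coact.
Qed.
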